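(* The randomized query complexity of the matrix game with parameter $n$ (a perfect square) is $\Theta(\sqrt n)$.
   Context: Matrix game: let $n\in\mathbb{N}$ be a perfect square and let $\mathcal{X}$ be the following set of $2\sqrt n$ matrices of size $\sqrt n\times\sqrt n$ with entries in $\{0,1,2\}$: the $\sqrt n$ ''row'' matrices, each having one row of all $1$s and all other entries $0$; and the $\sqrt n$ ''column'' matrices, each having one column of all $2$s and all other entries $0$. Given $n$ and oracle access to an unknown matrix $F\in\mathcal{X}$ (a query names a coordinate and receives the entry of $F$ there), the goal is to correctly declare whether $F$ is a row matrix or a column matrix. Randomized query complexity: the minimum over randomized algorithms that, for every input, output the correct answer with probability at least $9/10$, of the worst-case (over inputs) expected number of queries, the expectation being over the algorithm's coin tosses. *)

(* Defs.v *)
From HB Require Import structures.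
From mathcomp Require Import all_boot all_order all_algebra.
From mathcomp Require Import all_classical all_reals all_analysis.

Set Implicit Arguments.
Unset Strict Implicit.
Unset Printing Implicit Defensive.

Import Order.TTheory GRing.Theory Num.Theory.
Local Open Scope classical_set_scope.
Local Open Scope ring_scope.

(** Queries range over [Q], oracle answers over [A], outputs over [O]. *)

(** A deterministic adaptive query algorithm: given the answers received so
    far (in order), either ask the next query or halt with an output.  The past
    queries need not be recorded, being determined by the past answers.  The
    algorithm may fail to halt. *)
Definition strategy (Q A O : Type) : Type := seq A -> Q + O.

(** The answers received within the first [t] steps against the oracle [x];
    it stops growing once the algorithm has halted. *)
Fixpoint answers (Q A O : Type) (s : strategy Q A O) (x : Q -> A) (t : nat) :
    seq A :=
  if t is t'.+1 then
    let h := answers s x t' in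
    if s h is inl q then rcons h (x q) else h
  else [::].

Definition outputs (Q A O : Type) (s : strategy Q A O) (x : Q -> A) (o : O) :
    Prop :=
  exists t, s (answers s x t) = inr o.

(** Extended-real valued: it is [+oo] when the algorithm never halts. *)
Definition nb_queries (R : realType) (Q A O : Type) (s : strategy Q A O)
    (x : Q -> A) : \bar R :=
  ereal_sup [set ((size (answers s x t))%:R)%:E | t in [set: nat]].

(** A randomized algorithm is a random strategy: the coin tosses are the points
    of a probability space, and each decision depends measurably on them. *)
Definition measurable_strategy (d : measure_display) (T : measurableType d)
    (Q A O : finType) (S : T -> strategy Q A O) : Prop :=
  forall (h : seq A) (a : Q + O), measurable [set w | S w h = a].

Section query_complexity.
Context (R : realType) (Q A O I : finType).

(** A query problem: an input [x] is accessed through [oracle x], is promised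
    to lie in [X], and has correct output [f x]. *)
Variables (oracle : I -> Q -> A) (X : {set I}) (f : I -> O).

Definition succeeds (p : R) (d : measure_display) (T : measurableType d)
    (P : probability T R) (S : T -> strategy Q A O) : Prop :=
  forall x, x \in X ->
    (p%:E <= P [set w | outputs (S w) (oracle x) (f x)])%E.

Definition worst_case_cost (d : measure_display) (T : measurableType d)
    (P : probability T R) (S : T -> strategy Q A O) : \bar R :=
  ereal_sup [set (\int[P]_w nb_queries R (S w) (oracle x))%E
            | x in [set` X]].

Definition randomized_query_complexity (p : R) : \bar R :=
  ereal_inf [set c : \bar R |
    exists (d : measure_display) (T : measurableType d)
           (P : probability T R) (S : T -> strategy Q A O),
      [/\ measurable_strategy S, succeeds p P S & c = worst_case_cost P S]].

End query_complexity.

(** The matrices below have size [k] x [k], with [k] the square root of the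
    parameter of the game. *)
Definition row_matrix (k : nat) (i : 'I_k) : 'M['I_3]_k :=
  \matrix_(a, b) (if a == i then 1 else 0).

Definition col_matrix (k : nat) (j : 'I_k) : 'M['I_3]_k :=
  \matrix_(a, b) (if b == j then 2 else 0).

Definition row_matrices (k : nat) : {set 'M['I_3]_k} :=
  [set row_matrix i | i : 'I_k]%SET.

Definition col_matrices (k : nat) : {set 'M['I_3]_k} :=
  [set col_matrix j | j : 'I_k]%SET.

Definition entry (k : nat) (F : 'M['I_3]_k) (q : 'I_k * 'I_k) : 'I_3 :=
  F q.1 q.2.

(** The output [true] declares a row matrix, [false] a column matrix. *)
Definition matrix_game_complexity (R : realType) (k : nat) : \bar R :=
  randomized_query_complexity (@entry k)
    (row_matrices k :|: col_matrices k)%SET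
    (fun F => F \in row_matrices k) (9 / 10 : R).

(* Main.v *)
(** Upper bound: querying the diagonal reads exactly one nonzero entry, and
    that entry is the answer.  Lower bound, by Yao's argument on the [2k] inputs:
    [m] queries that all read [0] meet at most [m] rows and [m] columns, and on
    every input whose line they miss the run gives the answer it gives on the
    zero matrix, which is wrong for all rows or for all columns.  So a
    deterministic algorithm stopped after [m] queries is correct on at most
    [k + 2m] inputs.  Taking [m] about [k/5], this averages to a success
    probability of at most [7/10], whereas by Markov's inequality an expected
    cost below [k/50] would leave at least [4/5] after truncation. *)

Require Import Defs.
From mathcomp Require Import all_boot all_order all_algebra.
From mathcomp Require Import all_classical all_reals all_analysis.
From mathcomp Require Import measurable_realfun ring lra.

Set Implicit Arguments.
Unset Strict Implicit.
Unset Printing Implicit Defensive.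

Import Order.TTheory GRing.Theory Num.Theory.
Local Open Scope classical_set_scope.
Local Open Scope ring_scope.

(** * Runs of a deterministic strategy *)

Section deterministic.
Context {Q A O : Type}.
Implicit Types (s : strategy Q A O) (x y : Q -> A).

Lemma answers_halted s x o t u :
  s (answers s x t) = inr o -> (t <= u)%N -> answers s x u = answers s x t.
Proof.
move=> so /subnK <-; elim: (u - t)%N => //= n IH.
by rewrite IH so.
Qed.

Lemma outputs_unique s x t o o' :
  outputs s x o -> s (answers s x t) = inr o' -> o = o'.
Proof.
move=> [u su] st; have [tu|/ltnW ut] := leqP t u.
  by move: su; rewrite (answers_halted st tu) st => -[].
by move: st; rewrite (answers_halted su ut) su => -[].
Qed.

Lemma size_answers_le s x t : (size (answers s x t) <= t)%N.
Proof.
elim: t => //= t IH; case: (s (answers s x t)) => [q|o]; first by rewrite size_rcons.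
exact: leqW.
Qed.

Lemma size_answers_running s x t q :
  s (answers s x t) = inl q -> size (answers s x t) = t.
Proof.
elim: t q => //= t IH q; case E : (s (answers s x t)) => [q'|o]; last by rewrite E.
by rewrite size_rcons (IH _ E).
Qed.

Lemma size_answers_query s x t q :
  s (answers s x t) = inl q -> size (answers s x t.+1) = t.+1.
Proof. by move=> E; rewrite /= E size_rcons (size_answers_running E). Qed.

Definition queried s x (m : nat) : seq Q :=
  pmap (fun t => if s (answers s x t) is inl q then Some q else None) (iota 0 m).

Lemma size_queried s x m : (size (queried s x m) <= m)%N.
Proof. by rewrite size_pmap (leq_trans (count_size _ _)) ?size_iota. Qed.

End deterministic.

(** A run depends on the oracle only through the queries it makes. Agreement on the queries of the
    run on [y] suffices: by induction both runs have the same history, hence ask the same next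
    query. *)
Lemma answers_agree {Q : eqType} {A O : Type} (s : strategy Q A O)
    (x y : Q -> A) m :
  {in queried s y m, x =1 y} -> answers s x m = answers s y m.
Proof.
elim: m => //= m IH xy.
have {}IH : answers s x m = answers s y m.
  apply: IH => q; rewrite /queried mem_pmap => qm; apply: xy.
  by rewrite /queried mem_pmap -addn1 iotaD map_cat mem_cat qm.
rewrite IH; case E : (s (answers s y m)) => [q|o] //; congr rcons; apply: xy.
rewrite /queried mem_pmap; apply/mapP; exists m; first by rewrite mem_iota add0n ltnSn.
by rewrite E.
Qed.

(** A run that is not halted after [t] steps has made [t] queries and is about to make one more,
    hence [t.+1]. *)
Lemma nb_queries_ge (R : realType) {Q A O : Type} (s : strategy Q A O)
    (x : Q -> A) t q :
  s (answers s x t) = inl q -> (t.+1%:R%:E <= nb_queries R s x)%E.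
Proof.
move=> sq; apply: ereal_sup_ubound; exists t.+1 => //.
by rewrite (size_answers_query sq).
Qed.

Lemma nb_queries_ge0 (R : realType) {Q A O : Type} (s : strategy Q A O)
    (x : Q -> A) : (0 <= nb_queries R s x)%E.
Proof. by apply: ereal_sup_ubound; exists 0%N. Qed.

(** * Measurability of runs, and Markov's inequality for the number of queries *)

Section measurability.
Context {d : measure_display} {T : measurableType d} {Q A O : finType}.
Variables (S : T -> strategy Q A O) (x : Q -> A).
Hypothesis mS : measurable_strategy S.

Lemma measurable_answers_eq t h : measurable [set w | answers (S w) x t = h].
Proof.
elim: t h => /= [|t IH] h.
  have [->|h0] := eqVneq h [::]; first by rewrite (_ : mkset _ = setT) //; apply/seteqP.
  rewrite (_ : mkset _ = set0) //; apply/seteqP; split=> // w /= /esym/eqP.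
  by rewrite (negPf h0).
(* Split according to the previous history [g] and the decision [a] taken there. Histories are
   finite words over a finite alphabet, so the union is countable. *)
rewrite (_ : mkset _ = \bigcup_(g : seq A) \bigcup_(a : Q + O)
  (if (if a is inl q then rcons g (x q) else g) == h
   then [set w | answers (S w) x t = g] `&` [set w | S w g = a] else set0)).
  apply: countable_bigcupT_measurable => [|g]; first exact: countableP.
  apply: countable_bigcupT_measurable => [|a]; first exact: countableP.
  by case: ifP => _ //; apply: measurableI => //; exact: mS.
apply/seteqP; split => w /=.
  move=> wh; exists (answers (S w) x t) => //; exists (S w (answers (S w) x t)) => //.
  by rewrite wh eqxx.
by move=> [g _ [a _]]; case: eqP => //= ah [-> ->].
Qed.

Lemma measurable_answers t (D : set (seq A)) :
  measurable [set w | D (answers (S w) x t)].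
Proof.
rewrite (_ : mkset _ = \bigcup_(g : seq A)
  (if g \in D then [set w | answers (S w) x t = g] else set0)).
  apply: countable_bigcupT_measurable => [|g]; first exact: countableP.
  by case: ifP => _ //; exact: measurable_answers_eq.
apply/seteqP; split => w /=.
  by move=> Dw; exists (answers (S w) x t) => //; rewrite mem_set.
by move=> [g _]; case: ifPn => // /set_mem ? /= ->.
Qed.

Lemma measurable_decision t (D : set (Q + O)) :
  measurable [set w | D (S w (answers (S w) x t))].
Proof.
rewrite (_ : mkset _ = \bigcup_(g : seq A) \bigcup_(a : Q + O)
  (if a \in D
   then [set w | answers (S w) x t = g] `&` [set w | S w g = a] else set0)).
  apply: countable_bigcupT_measurable => [|g]; first exact: countableP.
  apply: countable_bigcupT_measurable => [|a]; first exact: countableP.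
  case: ifP => _ //; apply: measurableI; last exact: mS.
  exact: measurable_answers_eq.
apply/seteqP; split => w /=.
  move=> Dw; exists (answers (S w) x t) => //; exists (S w (answers (S w) x t)) => //.
  by rewrite mem_set.
by move=> [g _ [a _]]; case: ifPn => // /set_mem ? /= [-> ->].
Qed.

Lemma measurable_outputs o : measurable [set w | outputs (S w) x o].
Proof.
rewrite (_ : mkset _ = \bigcup_t [set w | S w (answers (S w) x t) = inr o]).
  by apply: bigcupT_measurable => t; exact: (measurable_decision t [set inr o]).
by apply/seteqP; split => w /= [t]; [exists t|move=> _; exists t].
Qed.

Lemma measurable_nb_queries (R : realType) :
  measurable_fun setT (fun w => nb_queries R (S w) x).
Proof.
(* As a supremum of a sequence, the number of queries inherits measurability from the history
   lengths. *)
rewrite (_ : (fun w => _) =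
  (fun w => esups (fun t => (size (answers (S w) x t))%:R%:E) 0)); last first.
  by apply/funext => w; congr ereal_sup; apply/seteqP; split => _ [t _ <-]; exists t.
apply: measurable_fun_esups => t _ Y mY; rewrite setTI.
exact: (measurable_answers t [set h | Y (size h)%:R%:E]).
Qed.

End measurability.

(** On the event that the run still queries after [m] steps, the number of queries is at least
    [m.+1]; integrate this pointwise bound. *)
Lemma markov_queries (R : realType) (d : measure_display) (T : measurableType d)
    (P : probability T R) (Q A O : finType) (S : T -> strategy Q A O)
    (x : Q -> A) m : measurable_strategy S ->
  (m.+1%:R%:E * P [set w | exists q, S w (answers (S w) x m) = inl q] <=
    \int[P]_w nb_queries R (S w) x)%E.
Proof.
move=> mS; set B := mkset _.
have mB : measurable B.
  exact: (measurable_decision x mS m [set a | exists q, a = inl q]).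
rewrite -[B]setIT -integral_indic// -ge0_integralZl//; last first.
  by apply/measurable_EFinP; exact: measurable_indic.
apply: ge0_le_integral => //.
- by apply/measurable_funeM/measurable_EFinP; exact: measurable_indic.
- exact: measurable_nb_queries.
move=> w _; rewrite indicE; case: (boolP (w \in B)) => [/set_mem[q wq]|_].
  by rewrite mule1; exact: nb_queries_ge wq.
by rewrite mule0 nb_queries_ge0.
Qed.

(** * Row and column matrices, and the count of inputs answered correctly *)

Lemma entry_row_matrix k (i : 'I_k) q :
  entry (row_matrix i) q = if q.1 == i then 1 else 0.
Proof. by rewrite /entry mxE. Qed.

Lemma entry_col_matrix k (j : 'I_k) q :
  entry (col_matrix j) q = if q.2 == j then 2 else 0.
Proof. by rewrite /entry mxE. Qed.

Lemma row_matrix_in k (i : 'I_k) : row_matrix i \in row_matrices k.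
Proof. exact: imset_f. Qed.

Lemma col_matrix_notin k (j : 'I_k) : col_matrix j \notin row_matrices k.
Proof.
(* The entry at [(j, j)] is 2 in the column matrix, but 0 or 1 in a row matrix. *)
apply/imsetP => -[i _ /(congr1 (fun F => entry F (j, j)))].
by rewrite entry_row_matrix entry_col_matrix /= eqxx; case: ifP.
Qed.

(** To be used with [s] the lines met by the queries and [c] the correctness of the answer on the
    zero matrix: a line in [s] counts for at most 1, any other for at most [c]. *)
Lemma sum_mem_le (I : finType) (s : seq I) m (b : I -> bool) (c : bool) :
  (size s <= m)%N -> (forall i, i \notin s -> b i -> c) ->
  (\sum_i b i <= m + #|I| * c)%N.
Proof.
move=> sm bc.
apply: (@leq_trans (\sum_i ((i \in s) + c))).
  apply: leq_sum => i _; case: (boolP (i \in s)) => [_|/bc].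
    by case: (b i).
  by case: (b i) => // ->.
rewrite big_split /= sum_nat_const leq_add2r.
by rewrite -big_mkcond sum1_card (leq_trans (card_size s)).
Qed.

Lemma correct_count k (s : strategy ('I_k * 'I_k)%type 'I_3 bool) m :
  (\sum_(i < k) (s (answers s (entry (row_matrix i)) m) == inr true) +
   \sum_(j < k) (s (answers s (entry (col_matrix j)) m) == inr false)
     <= k + m.*2)%N.
Proof.
(* The zero matrix is not an input; its run is shared by all inputs whose line it misses. *)
pose z (q : 'I_k * 'I_k) : 'I_3 := 0.
pose out := s (answers s z m).
have rowP : (\sum_(i < k) (s (answers s (entry (row_matrix i)) m) == inr true)
    <= m + #|'I_k| * (out == inr true))%N.
  apply: (@sum_mem_le _ (map fst (queried s z m))).
    by rewrite size_map size_queried.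
  move=> i iq; rewrite (@answers_agree _ _ _ _ _ z) // => q qm.
  rewrite entry_row_matrix; case: eqP => // qi.
  by move: iq; rewrite -qi (map_f fst qm).
have colP : (\sum_(j < k) (s (answers s (entry (col_matrix j)) m) == inr false)
    <= m + #|'I_k| * (out == inr false))%N.
  apply: (@sum_mem_le _ (map snd (queried s z m))).
    by rewrite size_map size_queried.
  move=> j jq; rewrite (@answers_agree _ _ _ _ _ z) // => q qm.
  rewrite entry_col_matrix; case: eqP => // qj.
  by move: jq; rewrite -qj (map_f snd qm).
apply: leq_trans (leq_add rowP colP) _.
rewrite card_ord addnACA addnn addnC leq_add2r -mulnDr -[leqRHS]muln1 leq_mul2l.
(* The single decision [out] cannot be both [inr true] and [inr false], so the term [k] is counted
   at most once. *)
by apply/orP; right; case: (out) => [|[]].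
Qed.

(** * Truncation, averaging over the coin tosses, and the lower bound *)

Lemma succeeds_le (R : realType) (d : measure_display) (T : measurableType d)
    (P : probability T R) (Q A O : finType) (S : T -> strategy Q A O)
    (x : Q -> A) o m : measurable_strategy S ->
  (P [set w | outputs (S w) x o] <=
    P [set w | S w (answers (S w) x m) = inr o] +
    P [set w | exists q, S w (answers (S w) x m) = inl q])%E.
Proof.
move=> mS; set A1 := [set w | _ = inr _]; set B := [set w | exists q, _].
have mA : measurable A1 by exact: (measurable_decision x mS m [set inr o]).
have mB : measurable B.
  exact: (measurable_decision x mS m [set a | exists q, a = inl q]).
apply: le_trans (measureU2 P mA mB).
apply: le_measure; rewrite ?inE; first exact: measurable_outputs.
  exact: measurableU.
(* Either the run is still querying at step [m], or it has halted and its output, being unique, is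
   already [o]. *)
move=> w /= wo; case E : (S w (answers (S w) x m)) => [q|o'].
  by right; exists q.
by left; rewrite /A1 /= E (outputs_unique wo E).
Qed.

(** The left side is the expected number of inputs answered correctly at step [m]; [correct_count]
    bounds this number for each outcome of the coins. *)
Lemma correct_mass (R : realType) k (d : measure_display) (T : measurableType d)
    (P : probability T R) (S : T -> strategy ('I_k * 'I_k)%type 'I_3 bool) m :
  measurable_strategy S ->
  (\sum_(i < k) P [set w | S w (answers (S w) (entry (row_matrix i)) m) = inr true] +
   \sum_(j < k) P [set w | S w (answers (S w) (entry (col_matrix j)) m) = inr false]
     <= (k + m.*2)%:R%:E)%E.
Proof.
move=> mS.
have mD (x : 'I_k * 'I_k -> 'I_3) o :
    measurable [set w | S w (answers (S w) x m) = inr o].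
  exact: (measurable_decision x mS m [set inr o]).
have mI (x : 'I_k * 'I_k -> 'I_3) o : measurable_fun setT
    (fun w => (\1_[set w | S w (answers (S w) x m) = inr o] w)%:E : \bar R).
  by apply/measurable_EFinP; exact: measurable_indic.
under eq_bigr => i _ do rewrite -[X in P X]setIT -integral_indic//.
under [X in (_ + X)%E]eq_bigr => i _ do rewrite -[X in P X]setIT -integral_indic//.
rewrite -!ge0_integral_sum// -ge0_integralD//; last 4 first.
- by move=> w _; apply: sume_ge0.
- by apply: emeasurable_sum.
- by move=> w _; apply: sume_ge0.
- by apply: emeasurable_sum.
rewrite -[leRHS]mule1 -(probability_setT P) -integral_cst//.
apply: ge0_le_integral => //.
- by move=> w _; apply: adde_ge0; apply: sume_ge0.
- by apply: emeasurable_funD; apply: emeasurable_sum.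
move=> w _; rewrite !sumEFin -EFinD lee_fin.
have indE (x : 'I_k * 'I_k -> 'I_3) o :
    \1_[set w | S w (answers (S w) x m) = inr o] w
      = (S w (answers (S w) x m) == inr o)%:R :> R.
  rewrite indicE; congr (nat_of_bool _)%:R.
  by apply/idP/eqP => [/set_mem|?]; last exact: mem_set.
under eq_bigr do rewrite indE.
under [X in _ + X]eq_bigr do rewrite indE.
by rewrite -!natr_sum -natrD ler_nat correct_count.
Qed.

Lemma matrix_game_lower (R : realType) k : (0 < k)%N ->
  ((50^-1 * k%:R)%:E <= matrix_game_complexity R k)%E.
Proof.
move=> k0; apply: le_ereal_inf_tmp => _ [d [T [P [S [mS sS ->]]]]].
(* Suppose the cost is below [k / 50]. With [m] the integer part of [k / 5], one has
   [5 m <= k <= 5 (m + 1)]. *)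
set W := worst_case_cost _ _ _ _; rewrite leNgt; apply/negP => Wk.
pose m := (k %/ 5)%N.
have kpos : (0 < k%:R :> R) by rewrite ltr0n.
have km : (k%:R <= 5 * m.+1%:R :> R).
  by rewrite -natrM ler_nat ltnW// mulnC -ltn_divLR.
have mk : (5 * m%:R <= k%:R :> R).
  by rewrite -natrM ler_nat mulnC leq_trunc_div.
have err x : x \in (row_matrices k :|: col_matrices k)%SET ->
    ((4 / 5)%:E <=
      P [set w | S w (answers (S w) (entry x) m) = inr (x \in row_matrices k)])%E.
  move=> xX; set Pa := P _.
  have := le_trans (sS x xX) (succeeds_le P (entry x) (x \in row_matrices k) m mS).
  rewrite -/Pa; set Pb := P _.
  have : (m.+1%:R%:E * Pb <= (50^-1 * k%:R)%:E)%E.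
    apply: le_trans (markov_queries P _ m mS) _; apply: le_trans (ltW Wk).
    by apply: ereal_sup_ubound; exists x.
  have Pab : Pb \is a fin_num /\ Pa \is a fin_num.
    by split; apply: fin_num_measure;
      [exact: (measurable_decision _ mS m [set a | exists q, a = inl q])
      |exact: (measurable_decision _ mS m [set inr (x \in row_matrices k)])].
  case: Pab => /fineK <- /fineK <-; rewrite -EFinM -EFinD !lee_fin.
  set b := fine _; set a := fine _ => mb ab.
  (* Markov gives [(m + 1) b <= k / 50 <= (m + 1) / 10]. Truncation thus lowers the success
     probability from 9/10 to no less than 4/5. *)
  have : b <= 10^-1 by rewrite -(@ler_pM2l _ m.+1%:R) ?ltr0Sn//; lra.
  by lra.
(* Each of the [k] rows and [k] columns contributes at least 4/5 to the total mass, while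
   [k + 2 m <= 7 k / 5]: a contradiction since [k > 0]. *)
have low : ((8 / 5 * k%:R)%:E <= (k + m.*2)%:R%:E :> \bar R)%E.
  apply: le_trans (correct_mass P m mS).
  rewrite (_ : 8 / 5 * k%:R = (\sum_(i < k) (4/5)) + (\sum_(i < k) (4/5))); last first.
    by rewrite sumr_const card_ord -mulr_natr; field.
  rewrite EFinD -!sumEFin; apply: leeD; apply: lee_sum => i _.
    have := err (row_matrix i); rewrite row_matrix_in; apply.
    by rewrite inE row_matrix_in.
  have := err (col_matrix i); rewrite (negPf (col_matrix_notin i)); apply.
  by rewrite inE; apply/orP; right; exact: imset_f.
move: low; rewrite lee_fin natrD -muln2 natrM.
by lra.
Qed.

(** * The upper bound: reading the diagonal *)

Definition diagonal_strategy k : strategy ('I_k * 'I_k)%type 'I_3 bool :=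
  fun h => if insub (size h) is Some i then inl (i, i) else inr (1 \in h).

(** The number of answers received is the index of the next diagonal position. It is a valid ordinal
    exactly while it is below [k], so [insub] drives the queries and then the halt. *)
Lemma diagonal_answers k (x : 'I_k * 'I_k -> 'I_3) t : (t <= k)%N ->
  answers (@diagonal_strategy k) x t =
    [seq x (i, i) | i <- take t (enum 'I_k)].
Proof.
elim: t => [|t IH] tk; first by rewrite take0.
rewrite /= IH 1?ltnW// /diagonal_strategy size_map size_take size_enum_ord tk.
rewrite insubT (take_nth (Ordinal tk)) ?size_enum_ord// map_rcons.
by congr (rcons _ (x (_, _))); apply: val_inj; rewrite /= nth_enum_ord.
Qed.

Lemma diagonal_halts k (x : 'I_k * 'I_k -> 'I_3) :
  @diagonal_strategy k (answers (@diagonal_strategy k) x k)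
    = inr [exists i, x (i, i) == 1].
Proof.
rewrite diagonal_answers// take_oversize ?size_enum_ord//.
rewrite /diagonal_strategy insubN; last by rewrite size_map size_enum_ord ltnn.
congr inr; apply/mapP/existsP => [[i _ ->]|[i /eqP xi]]; exists i => //.
by rewrite mem_enum.
Qed.

Lemma diagonal_cost (R : realType) k (x : 'I_k * 'I_k -> 'I_3) :
  (nb_queries R (@diagonal_strategy k) x <= k%:R%:E)%E.
Proof.
apply: ge_ereal_sup => _ [t _ <-]; rewrite lee_fin ler_nat.
have [tk|kt] := leqP t k; first exact: leq_trans (size_answers_le _ _ _) tk.
by rewrite (answers_halted (diagonal_halts x) (ltnW kt)) size_answers_le.
Qed.

Lemma matrix_game_upper (R : realType) k :
  (matrix_game_complexity R k <= k%:R%:E)%E.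
Proof.
(* A deterministic algorithm is a randomized one over a one-point probability space. *)
pose P : probability unit R := \d_tt.
pose S (_ : unit) := @diagonal_strategy k.
apply: (@le_trans _ _ (worst_case_cost (@entry k)
    (row_matrices k :|: col_matrices k)%SET P S)).
  apply: ereal_inf_lbound; exists _, _, P, S; split => //.
  move=> x xX; rewrite (_ : [set w | _] = setT).
    by rewrite probability_setT lee_fin; lra.
  apply/seteqP; split => // w _ /=; exists k; rewrite /S diagonal_halts.
  congr inr; move: xX; rewrite inE => /orP[] /imsetP[i _ ->].
    rewrite row_matrix_in; apply/existsP; exists i.
    by rewrite entry_row_matrix /= eqxx.
  rewrite (negPf (col_matrix_notin i)); apply/existsP => -[j].
  by rewrite entry_col_matrix /=; case: ifP.
apply: ge_ereal_sup => _ [x _ <-].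
rewrite (integral_cst P measurableT (nb_queries R (@diagonal_strategy k) (entry x))).
by rewrite [X in (_ * X)%E](probability_setT P) mule1; exact: diagonal_cost.
Qed.

Theorem lemma1 (R : realType) :
  exists c C : R, [/\ 0 < c, 0 < C &
    \forall n \near \oo, forall k : nat, n = (k ^ 2)%N ->
      ((c * Num.sqrt n%:R)%:E <= matrix_game_complexity R k)%E /\
      (matrix_game_complexity R k <= (C * Num.sqrt n%:R)%:E)%E].
Proof.
exists 50^-1, 1; split; rewrite ?invr_gt0 ?ltr01 ?ltr0n//.
(* The threshold 1 excludes [n = 0], which gives the [0 < k] required by the lower bound. *)
exists 1%N => // n /= n0 k nk.
have k0 : (0 < k)%N by move: n0; rewrite nk expn_gt0 => /orP[].
rewrite nk natrX sqrtr_sqr ger0_norm// mul1r; split.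
  exact: matrix_game_lower.
exact: matrix_game_upper.
Qed.
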